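(* An arbitrary nonempty max-plus convex subset of $E$, equipped with the metric topology associated to $\mathsf{D}_{\mathbf{hu}}$, is an absolute retract.
   Context: $E\neq\{0\}$ is an Archimedean Riesz space (real vector lattice; Archimedean means that if $ny\leqslant x$ for all $n\in\mathbb{N}$ then $y\leqslant 0$), and $\mathbf{u}\in E_+$ is a unit: for every $x\in E_+$ there is $n\in\mathbb{N}$ with $x\leqslant n\mathbf{u}$. $\mathsf{D}_{\mathbf{hu}}(x,y)=\max\{0,\mathbf{p}_{\mathbf{u}}(x-y)\}+\max\{0,\mathbf{p}_{\mathbf{u}}(y-x)\}$, where $\mathbf{p}_{\mathbf{u}}(x)=\inf\{t\in\mathbb{R}:x\leqslant t\mathbf{u}\}$; this is a metric on $E$. The max-plus convex hull of a nonempty $S\subset E$ is the set $[\![S]\!]$ of all elements $(x_1+t_1\mathbf{u})\vee\cdots\vee(x_m+t_m\mathbf{u})$ with $m\ge1$, $x_i\in S$, $t_i\in\mathbb{R}$ and $\max_i t_i=0$; $[\![\emptyset]\!]=\emptyset$. A set $C\subset E$ is max-plus convex if $C=[\![C]\!]$. An absolute retract is a metrizable space that is a retract of every metrizable space containing it as a closed subspace. *)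

(* Defs.v *)
From HB Require Import structures.
From mathcomp Require Import all_boot all_order all_algebra.
From mathcomp Require Import all_classical all_reals all_analysis.

Set Implicit Arguments.
Unset Strict Implicit.
Unset Printing Implicit Defensive.

Import Order.TTheory GRing.Theory Num.Theory.
Local Open Scope classical_set_scope.
Local Open Scope ring_scope.

(** * Riesz spaces *)

(* The lattice operations are fields rather than an [Order.Lattice] structure:
   the latter has no common join with the additive structures below
   [realDomainType], which prevents declaring a new structure combining them. *)
HB.mixin Record POrderedZmodule_isRiesz (R : numDomainType) E
    & GRing.Lmodule R E & Num.POrderedZmodule E := {
  riesz_leD2r : forall z x y : E, x <= y -> x + z <= y + z ;
  riesz_scale_ge0 : forall (a : R) (x : E), 0 <= a -> 0 <= x -> 0 <= a *: x ;
  riesz_join : E -> E -> E ;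
  riesz_meet : E -> E -> E ;
  riesz_leUx : forall x y z : E,
    (riesz_join x y <= z) = (x <= z) && (y <= z) ;
  riesz_lexI : forall x y z : E,
    (z <= riesz_meet x y) = (z <= x) && (z <= y)
}.

#[short(type="rieszType")]
HB.structure Definition Riesz (R : numDomainType) :=
  {E of GRing.Lmodule R E & Num.POrderedZmodule E
      & POrderedZmodule_isRiesz R E}.

Section RieszDefs.
Context {R : realType} {E : rieszType R}.
Implicit Types (u x y : E) (S C : set E).

Definition riesz_unit u : Prop :=
  0 <= u /\ forall x, 0 <= x -> exists n : nat, x <= u *+ n.

(* [inf] is the real-valued infimum, with the junk value 0 on sets that are
   empty or unbounded below; [pu_has_inf] below shows that this never occurs
   when E is nonzero and Archimedean and u is a unit. *)
Definition pu u x : R := inf [set t : R | x <= t *: u].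

Definition Dhu u x y : R := Num.max 0 (pu u (x - y)) + Num.max 0 (pu u (y - x)).

(* The number of terms is m.+1. The seeds of the two big operators are one of
   the iterated terms, so these are the maximum and the supremum of a nonempty
   finite family. *)
Definition maxplus_hull u S : set E :=
  [set y | exists m (x : 'I_m.+1 -> E) (t : 'I_m.+1 -> R),
    [/\ forall i, S (x i),
        \big[Num.max/t ord0]_(i < m.+1) t i = 0 &
        y = \big[riesz_join/(x ord0 + t ord0 *: u)]_(i < m.+1)
              (x i + t i *: u)]].

Definition maxplus_convex u C : Prop := C = maxplus_hull u C.

End RieszDefs.

Definition riesz_archimedean (R : realType) (E : rieszType R) : Prop :=
  forall x y : E, (forall n : nat, y *+ n <= x) -> y <= 0.

Definition riesz_nontrivial (R : realType) (E : rieszType R) : Prop :=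
  exists x : E, x != 0.

(** * The metric Dhu *)

Section DhuMetric.
Context {R : realType} {E : rieszType R} {u : E}.
Hypotheses (E_neq0 : riesz_nontrivial E) (E_archi : riesz_archimedean E).
Hypothesis (u_unit : riesz_unit u).
Implicit Types (x y z : E) (s t : R).

Lemma riesz_leUl x y : x <= riesz_join x y.
Proof. by have := lexx (riesz_join x y); rewrite riesz_leUx => /andP[]. Qed.

Lemma riesz_leUr x y : y <= riesz_join x y.
Proof. by have := lexx (riesz_join x y); rewrite riesz_leUx => /andP[]. Qed.

Lemma riesz_leD x y z t : x <= y -> z <= t *: u -> x + z <= y + t *: u.
Proof.
move=> xy zt; apply: le_trans (riesz_leD2r z _ _ xy) _.
by rewrite ![y + _]addrC; exact: riesz_leD2r.
Qed.

Lemma riesz_subr_ge0 x y : (0 <= y - x) = (x <= y).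
Proof.
apply/idP/idP => [/(riesz_leD2r x)|/(riesz_leD2r (- x))].
  by rewrite add0r subrK.
by rewrite subrr.
Qed.

Lemma riesz_leZ s t : s <= t -> s *: u <= t *: u.
Proof.
move=> st; rewrite -riesz_subr_ge0 -scalerBl.
by apply: riesz_scale_ge0; [rewrite subr_ge0|case: u_unit].
Qed.

Lemma riesz_unit_neq0 : u != 0.
Proof.
apply/eqP => u0; case: u_unit => _ uE; case: E_neq0 => x /eqP; apply.
have le0 z : z <= 0.
  apply: (@le_trans _ _ (riesz_join z 0)); first exact: riesz_leUl.
  have [n] := uE (riesz_join z 0) (riesz_leUr _ _).
  by rewrite u0 mul0rn.
apply/eqP; rewrite eq_le le0/=.
by move: (le0 (- x)) => /(riesz_leD2r x); rewrite addNr add0r.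
Qed.

Lemma riesz_leZE s t : (s *: u <= t *: u) = (s <= t).
Proof.
apply/idP/idP; last exact: riesz_leZ.
apply: contraTT; rewrite -ltNge => ts; apply/negP => /= stu.
have /eqP : (t - s) *: u = 0.
  apply/eqP; rewrite eq_le; apply/andP; split.
    have := riesz_leZ (ltW ts).
    by rewrite -riesz_subr_ge0 -scalerBl => /(riesz_leD2r (- ((s - t) *: u)));
      rewrite add0r subrr -scaleNr opprB.
  by rewrite scalerBl riesz_subr_ge0.
by rewrite scaler_eq0 (negbTE riesz_unit_neq0) orbF subr_eq0 lt_eqF.
Qed.

Lemma pu_ubound x : exists2 t : R, 0 <= t & x <= t *: u.
Proof.
have [n xn] := u_unit.2 (riesz_join x 0) (riesz_leUr _ _).
by exists n%:R => //; rewrite scaler_nat (le_trans _ xn)// riesz_leUl.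
Qed.

Lemma pu_has_inf x : has_inf [set t : R | x <= t *: u].
Proof.
split; first by have [t _ xt] := pu_ubound x; exists t.
have [s _ xs] := pu_ubound (- x).
exists (- s) => t /= xt; rewrite -riesz_leZE scaleNr -riesz_subr_ge0 opprK.
by rewrite addrC -(addNr x); exact: riesz_leD.
Qed.

Lemma pu_le x t : x <= t *: u -> pu u x <= t.
Proof. by move=> xt; apply: ge_inf => //; case: (pu_has_inf x). Qed.

Lemma le_pu x : x <= pu u x *: u.
Proof.
rewrite -riesz_subr_ge0 -[X in _ <= X]opprB.
suff h : x - pu u x *: u <= 0.
  have := riesz_leD2r (- (x - pu u x *: u)) _ _ h.
  by rewrite subrr add0r.
apply: (E_archi (x := u)) => n; case: n => [|n].
  by rewrite mulr0n; case: u_unit.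
have n0 : 0 < n.+1%:R^-1 :> R by rewrite invr_gt0 ltr0n.
have [t /= xt ltt] := inf_adherent n0 (pu_has_inf x).
have {}xt : x - pu u x *: u <= n.+1%:R^-1 *: u.
  rewrite (le_trans (riesz_leD2r _ _ _ xt))// -scalerBl riesz_leZE.
  by rewrite lerBlDl ltW.
rewrite -riesz_subr_ge0 -scaler_nat.
have -> : u - n.+1%:R *: (x - pu u x *: u) =
    n.+1%:R *: (n.+1%:R^-1 *: u - (x - pu u x *: u)) :> E.
  by rewrite [RHS]scalerBr scalerA divff ?scale1r// pnatr_eq0.
by apply: riesz_scale_ge0; rewrite ?ler0n// riesz_subr_ge0.
Qed.

Lemma pu0 : pu u 0 = 0.
Proof.
apply/eqP; rewrite eq_le pu_le ?scale0r//=.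
by have := le_pu 0; rewrite -[X in X <= _](scale0r u) riesz_leZE.
Qed.

Lemma puD x y : pu u (x + y) <= pu u x + pu u y.
Proof. by apply: pu_le; rewrite scalerDl; apply: riesz_leD; exact: le_pu. Qed.

Lemma Dhuxx x : Dhu u x x = 0.
Proof. by rewrite /Dhu subrr pu0 maxxx addr0. Qed.

Lemma Dhu_positivity x y : Dhu u x y = 0 -> x = y.
Proof.
have ge0 z : 0 <= Num.max 0 (pu u z) by rewrite le_max lexx.
have le0 a b : Num.max 0 (pu u (a - b)) = 0 -> a <= b.
  move=> m0; have p0 : pu u (a - b) <= 0 by rewrite -m0 le_max lexx orbT.
  have := le_trans (le_pu (a - b)) (riesz_leZ p0).
  by rewrite scale0r => /(riesz_leD2r b); rewrite subrK add0r.
move=> /eqP; rewrite /Dhu paddr_eq0// => /andP[/eqP xy /eqP yx].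
by apply/le_anti; rewrite !le0.
Qed.

Lemma Dhu_sym x y : Dhu u x y = Dhu u y x.
Proof. exact: addrC. Qed.

Lemma Dhu_triangle y x z : Dhu u x z <= Dhu u x y + Dhu u y z.
Proof.
have maxD a b : Num.max 0 (pu u (a + b)) <=
    Num.max 0 (pu u a) + Num.max 0 (pu u b).
  rewrite ge_max addr_ge0 ?le_max ?lexx//=.
  by rewrite (le_trans (puD _ _))// lerD// le_max lexx orbT.
rewrite /Dhu addrACA; apply: lerD.
  by have -> : x - z = (x - y) + (y - z) by rewrite addrA subrK.
by rewrite addrC; have -> : z - x = (z - y) + (y - x) by rewrite addrA subrK.
Qed.

End DhuMetric.

(* E with the metric Dhu u; the hypotheses are phantom parameters under which
   Dhu u is a metric. *)
Definition hu_space (R : realType) (E : rieszType R) (u : E)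
  (E_neq0 : riesz_nontrivial E) (E_archi : riesz_archimedean E)
  (u_unit : riesz_unit u) : Type := E.

Section HuSpace.
Context (R : realType) (E : rieszType R) (u : E).
Context (E_neq0 : riesz_nontrivial E) (E_archi : riesz_archimedean E).
Context (u_unit : riesz_unit u).

HB.instance Definition _ := Choice.copy (hu_space E_neq0 E_archi u_unit) E.

HB.instance Definition _ :=
  @isMetric.Build R (hu_space E_neq0 E_archi u_unit) (Dhu u)
    (Dhuxx E_neq0 E_archi u_unit) (Dhu_positivity E_neq0 E_archi u_unit)
    (Dhu_sym (u := u)) (Dhu_triangle E_neq0 E_archi u_unit).

End HuSpace.

(** * Absolute retracts *)

Definition is_metric (R : realType) (X : Type) (d : X -> X -> R) : Prop :=
  [/\ forall x y, d x y = 0 <-> x = y,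
      forall x y, d x y = d y x &
      forall x y z, d x z <= d x y + d y z].

Definition metrizable (R : realType) (X : topologicalType) : Prop :=
  exists2 d : X -> X -> R, is_metric d &
    forall x, nbhs x = filter_from [set e : R | 0 < e]
                                   (fun e => [set y | d x y < e]).

Definition homeomorphic (X Y : topologicalType) : Prop :=
  exists (f : X -> Y) (g : Y -> X),
    [/\ continuous f, continuous g, cancel f g & cancel g f].

(* Here A, used as a type, is [set_type A] with the subspace topology. *)
Definition is_retract (Y : topologicalType) (A : set Y) : Prop :=
  exists2 r : Y -> A, continuous r & forall a : A, r (set_val a) = a.

(* "Y contains X as a closed subspace" is read up to homeomorphism. All
   [realType]s being isomorphic, the choice of R is immaterial. *)
Definition absolute_retract (R : realType) (X : topologicalType) : Prop :=
  metrizable R X /\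
  forall (Y : topologicalType) (A : set Y),
    metrizable R Y -> closed A -> homeomorphic X A -> is_retract A.

(* Main.v *)
Require Import Defs.
From mathcomp Require Import all_boot all_order all_algebra.
From mathcomp Require Import all_classical all_reals all_analysis.
From mathcomp Require Import wochoice lra.

(** Dugundji's extension theorem, with convex combinations replaced by max-plus
ones. Let A be closed in a metric space (Y, d) and f : A -> C continuous; a
continuous extension F : Y -> C of f is built, and applying it to a
homeomorphism from A onto C gives a retraction of Y onto A.

Off A the extension has the form
  F y = sup_n (f (k_n y) + t_n y u),   t_n y <= 0,  max_n t_n y = 0,
a supremum over finitely many n, so that F y lies in C by max-plus convexity.
The points k_n y of A satisfy d y (k_n y) <= 2 d y b for all b in A. Hence when
y tends to a point a of A, so do all k_n y; the values f (k_n y) are then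
uniformly close to f a, and so is any of their max-plus combinations
([is_join_within_unit]).

The indices and weights come from A. H. Stone's proof that metric spaces are
paracompact ([sigma_discrete_bumps]). The cover of the complement of A by the
interiors of the sets [almost_nearest a] has a refinement made of countably many
discrete families, which is described by bumps g_n with 0 <= g_n <= 1 / (n + 1)
together with a choice k_n y of a member of the cover, locally constant where
g_n > 0. As a discrete family has at most one member near each point, a single
index n accounts for the whole n-th family.

Let M = sup_n g_n, which is positive off A and is attained. Only the n with
g_n y > M y / 2 enter the supremum; because g_n tends to 0 uniformly and M is
continuous, near a given point off A they are among finitely many indices. The
weight t_n = 1 - M / (2 g_n - M) vanishes where g_n = M and tends to -oo as g_n
decreases to M / 2, so that a term is absorbed by the others before it
disappears. This makes F continuous off A ([maxplus_join_near]).

Closeness in E is expressed by x <= y + e u and y <= x + e u, which is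
equivalent to smallness of Dhu u x y up to a factor 2. *)

Set Implicit Arguments.
Unset Strict Implicit.
Unset Printing Implicit Defensive.

Import Order.TTheory GRing.Theory Num.Theory numFieldNormedType.Exports.
Local Open Scope classical_set_scope.
Local Open Scope ring_scope.

(** * Bumps subordinate to an open cover of a metric space *)

Definition nonexpansive (R : realType) (Y : Type) (d : Y -> Y -> R)
  (h : Y -> R) := forall y z, h y <= h z + d y z.

Section MetricTopology.
Context {R : realType} {Y : topologicalType} {d : Y -> Y -> R}.
Hypothesis d_metric : is_metric d.
Hypothesis nbhs_d : forall x, nbhs x =
  filter_from [set e : R | 0 < e] (fun e => [set y | d x y < e]).

Let dxx x : d x x = 0.
Proof. by case: d_metric => d0 _ _; apply/d0. Qed.

Let dC x y : d x y = d y x.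
Proof. by case: d_metric. Qed.

Let d_triangle y x z : d x z <= d x y + d y z.
Proof. by case: d_metric. Qed.

Let d_ge0 x y : 0 <= d x y.
Proof. by have := d_triangle y x x; rewrite dxx (dC y x); lra. Qed.

Lemma near_dist x (e : R) : 0 < e -> \forall y \near x, d x y < e.
Proof. by move=> e0; rewrite /prop_near1 nbhs_d; exists e. Qed.

Lemma nonexpansive_continuous h : nonexpansive d h -> continuous h.
Proof.
move=> hL y; apply/cvgrPdist_lt => e e0.
near=> z; have yz : d y z < e by near: z; exact: near_dist.
have := hL y z; have := hL z y; rewrite (dC z y) ltr_distlC => *.
by apply/andP; split; lra.
Unshelve. all: by end_near. Qed.

Lemma nonexpansive_sup (H : set (Y -> R)) : H !=set0 ->
  (forall y, has_ubound [set h y | h in H]) ->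
  (forall h, H h -> nonexpansive d h) ->
  nonexpansive d (fun y => sup [set h y | h in H]).
Proof.
move=> [h0 Hh0] Hub HL y z; apply: ge_sup; first by exists (h0 y), h0.
move=> _ [h Hh <-]; apply: le_trans (HL h Hh y z) _.
by rewrite lerD2r; apply: ub_le_sup => //; exists h.
Qed.

(** Stone's construction. Well-order I and, at level n, attach each point x to
the first O i that contains x, provided that this O i contains the ball of
radius 3 r about x, where r = 1 / (n + 1). Points attached to different members
are at distance at least 3 r: otherwise each would lie in the member of the
other, and both indices could not be the least. Therefore at most one i is such
that some point attached to O i is at distance less than r from y. This i is
k n y, and g n is the supremum of the cones of height r over all attached
points. A point of the union of the O i is attached to a member as soon as n is
large. *)
Lemma sigma_discrete_bumps (I : choiceType) (i0 : I) (O : I -> set Y) :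
  (forall i, open (O i)) ->
  exists (g : nat -> Y -> R) (k : nat -> Y -> I),
  [/\ forall n y, 0 <= g n y <= n.+1%:R^-1,
      forall n, nonexpansive d (g n),
      forall i y, O i y -> exists n, 0 < g n y,
      forall n y, 0 < g n y -> O (k n y) y &
      forall n y, 0 < g n y -> \forall z \near y, k n z = k n y].
Proof.
move=> Oo.
have [leI leI_wo] := well_ordering_principle I.
have leI_anti i j : leI i j -> leI j i -> i = j.
  move=> ij ji.
  have [|l [_ l_uniq]] := leI_wo [pred l | (l == i) || (l == j)].
    by exists i; rewrite inE eqxx.
  have leI_refl h : leI h h.
    have [|_ [[/eqP -> hmin] _]] := leI_wo (pred1 h); first by exists h; rewrite inE.
    by apply: hmin; rewrite inE.
  rewrite -(l_uniq i) ?(l_uniq j)//; split; rewrite ?inE ?eqxx ?orbT//.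
    by move=> h /pred2P[]->.
  by move=> h /pred2P[]->.
pose r n : R := n.+1%:R^-1.
have r0 n : 0 < r n by rewrite invr_gt0.
pose core n i : set Y := [set x |
  (forall z, d x z < 3 * r n -> O i z) /\ (forall j, O j x -> leI i j)].
pose near_core n i : set Y := [set z | exists2 x, core n i x & d x z < r n].
have near_core_uniq n i j z : near_core n i z -> near_core n j z -> i = j.
  move=> [x [xi ximin] xz] [x' [x'j x'jmin] x'z].
  have xx' : d x x' < 3 * r n.
    by have := d_triangle z x x'; rewrite (dC z x'); have := r0 n; lra.
  by apply: leI_anti; [apply/ximin/x'j; rewrite dC | apply/x'jmin/xi].
pose cones n : set (Y -> R) := [set h |
  h = cst 0 \/ exists x, (exists i, core n i x) /\ h = (fun y => r n - d x y)].
have conesub n y : ubound [set h y | h in cones n] (r n).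
  move=> _ [h [->|[x [_ ->]]] <-]/=; first exact/ltW.
  by rewrite gerBl d_ge0.
have cones0 n : cones n (cst 0) by left.
pose g n y := sup [set h y | h in cones n].
have gle n y h : cones n h -> h y <= g n y.
  by move=> ch; apply: ub_le_sup; [exists (r n) | exists h].
have gP n y : 0 < g n y -> exists i, near_core n i y.
  move=> /sup_gt [|_ [h + <-]]; first by exists 0, (cst 0).
  case=> [->|[x [[i xi] ->]]]; first by rewrite ltxx.
  by rewrite subr_gt0; exists i, x.
pose k n y := xget i0 [set i | near_core n i y].
have kE n i z : near_core n i z -> k n z = i.
  move=> zi; apply: (near_core_uniq n _ _ z) => //.
  by have /= := @xgetPex _ i0 [set i | near_core n i z] (ex_intro _ i zi).
exists g, k; split.
- move=> n y; apply/andP; split; first exact: (gle n y (cst 0)).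
  by apply: ge_sup; [exists 0, (cst 0) | exact: conesub].
- move=> n; apply: nonexpansive_sup; first by exists (cst 0).
    by move=> y; exists (r n).
  move=> h [->|[x [_ ->]]] y z /=.
    by rewrite add0r d_ge0.
  by have := d_triangle y x z; lra.
- move=> i y Oy.
  have [|i1 [[i1O i1min] _]] := leI_wo [pred j | `[< O j y >]].
    by exists i; exact/asboolP.
  have /= i1y : O i1 y by exact/asboolP.
  have : nbhs y (O i1) by apply: open_nbhs_nbhs; split.
  rewrite nbhs_d => -[e /= e0 eO].
  have [n ne] : exists n, 3 * r n < e.
    have e30 : 0 < e / 3 by rewrite divr_gt0.
    have [n _ nP] := near_infty_natSinv_lt (PosNum e30).
    by exists n; have := nP n (leqnn n); rewrite /r /= ltr_pdivlMr// mulrC.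
  exists n; apply: (lt_le_trans (r0 n)).
  apply: le_trans (gle n y (fun z => r n - d y z) _).
    by rewrite dxx subr0.
  right; exists y; split => //; exists i1; split.
    by move=> z yz; apply: eO => /=; apply: lt_trans yz _.
  by move=> j Oj; exact/i1min/asboolP.
- move=> n y /gP[i yi]; rewrite (kE _ _ _ yi); case: yi => x [xO _] xy.
  by apply: xO; have := r0 n; lra.
- move=> n y /gP[i yi]; rewrite (kE _ _ _ yi); case: yi => x xi xy.
  have rxy : 0 < r n - d x y by rewrite subr_gt0.
  near=> z; apply: kE; exists x => //; have := d_triangle y x z.
  suff : d y z < r n - d x y by lra.
  by near: z; exact: near_dist.
Unshelve. all: by end_near. Qed.

End MetricTopology.

(** * Suprema of null sequences *)

Section SupNullSequence.
Context {R : realType} (a : nat -> R).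
Hypothesis a_bound : forall n, 0 <= a n <= n.+1%:R^-1.

Lemma null_sequence_ubound : has_ubound (range a).
Proof.
exists 1 => _ [n _ <-]; have /andP[_ /le_trans] := a_bound n; apply.
by rewrite invf_le1// ler1n.
Qed.

Lemma null_sequence_max n0 : 0 < a n0 -> exists n, a n = sup (range a).
Proof.
move=> an0; have S0 : 0 < sup (range a).
  by apply: lt_le_trans an0 _; apply: (ub_le_sup null_sequence_ubound); exists n0.
have S20 : 0 < sup (range a) / 2 by rewrite divr_gt0.
have [N _ NP] := near_infty_natSinv_lt (PosNum S20).
have [i _ imax] := @arg_maxP _ _ 'I_N.+1 ord0 xpredT (fun i => a i) isT.
exists i; apply/eqP; rewrite eq_le ub_le_sup/=; last first.
- by exists i.
- exact: null_sequence_ubound.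
have : sup (range a) <= Num.max (a i) (sup (range a) / 2).
  (* From N on, the terms are smaller than half of the supremum. *)
  apply: ge_sup; first by exists (a 0%N), 0%N.
  move=> _ [n _ <-]; rewrite le_max; have [nN|Nn] := ltnP n N.+1.
    by rewrite -[n]/(val (Ordinal nN)) [a _ <= _]imax.
  apply/orP; right; have /andP[_ /le_trans] := a_bound n; apply.
  by apply/ltW/(NP n)/ltnW.
by rewrite le_max => /orP[//|]; lra.
Qed.

End SupNullSequence.

(** * Max-plus combinations in a Riesz space *)

Definition within_unit (R : realType) (E : rieszType R) (u : E) (e : R)
  (x y : E) := x <= y + e *: u /\ y <= x + e *: u.

(** The supremum of a family is not an operation in E, as E need not be
complete; it is described by its universal property. *)
Definition is_join (R : realType) (E : rieszType R) (P : set nat)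
  (x : nat -> E) (z : E) := forall w, z <= w <-> forall n, P n -> x n <= w.

Section MaxPlus.
Context {R : realType} {E : rieszType R} {u : E}.
Hypothesis u_unit : riesz_unit u.
Implicit Types (x y z : E) (s t e : R) (C : set E) (P : set nat).

Lemma within_unit_sym e x y : within_unit u e x y -> within_unit u e y x.
Proof. by case. Qed.

Lemma within_unit_Dhu e x y (E_neq0 : riesz_nontrivial E) :
  0 <= e -> within_unit u e x y -> Dhu u x y <= e + e.
Proof.
move=> e0 [xy yx].
have le x1 x2 : x1 <= x2 + e *: u -> pu u (x1 - x2) <= e.
  move=> /(riesz_leD2r (- x2)); rewrite addrAC subrr add0r.
  exact: pu_le.
by rewrite /Dhu lerD// ge_max e0/= le.
Qed.

Lemma Dhu_within_unit e x y (E_neq0 : riesz_nontrivial E)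
  (E_archi : riesz_archimedean E) : Dhu u x y <= e -> within_unit u e x y.
Proof.
have le x1 x2 : Num.max 0 (pu u (x1 - x2)) <= e -> x1 <= x2 + e *: u.
  rewrite ge_max => /andP[_ pe].
  have := le_trans (le_pu E_neq0 E_archi u_unit (x1 - x2)) (riesz_leZ u_unit pe).
  by move=> /(riesz_leD2r x2); rewrite subrK addrC.
rewrite /Dhu => De.
have m0 z : 0 <= Num.max 0 (pu u z) by rewrite le_max lexx.
by split; apply: le; have := m0 (x - y); have := m0 (y - x); lra.
Qed.

Lemma big_riesz_join_le (I : eqType) (r : seq I) (x0 w : E) (x : I -> E) :
  \big[@riesz_join R E/x0]_(i <- r) x i <= w <->
  x0 <= w /\ {in r, forall i, x i <= w}.
Proof.
elim: r => [|i r [IH1 IH2]].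
  by rewrite big_nil; split=> [|[]//]; split.
rewrite big_cons riesz_leUx; split=> [/andP[xi /IH1[x0w xw]]|[x0w xw]].
  by split=> // j; rewrite inE => /predU1P[->//|/xw].
rewrite xw ?mem_head//=; apply: IH2; split=> // j jr.
by rewrite xw// inE jr orbT.
Qed.

(** The hypotheses on the weights say that their maximum is 0, so that the
supremum is one of the elements that the max-plus hull adjoins. *)
Lemma maxplus_join_mem C N P (c : nat -> E) (t : nat -> R) n0 :
  maxplus_convex u C -> (forall n, P n -> (n <= N)%N) ->
  (forall n, P n -> C (c n)) -> (forall n, P n -> t n <= 0) ->
  P n0 -> t n0 = 0 ->
  exists2 z, C z & is_join P (fun n => c n + t n *: u) z.
Proof.
move=> CE PN Pc Pt Pn0 tn0.
(* The indices up to N outside P are given the term n0 again. *)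
pose k (n : nat) := if `[< P n >] then n else n0.
have Pk n : P (k n) by rewrite /k; case: asboolP.
have kP n : P n -> k n = n by rewrite /k; case: asboolP.
exists (\big[@riesz_join R E/c (k 0%N) + t (k 0%N) *: u]_(i < N.+1)
   (c (k i) + t (k i) *: u)).
  rewrite CE; exists N, (fun i => c (k i)), (fun i => t (k i)); split => //.
    by move=> i; exact/Pc.
  apply/eqP; rewrite eq_le; apply/andP; split.
    by apply: bigmax_le => [|i _]; exact/Pt.
  have lt_n0 : (n0 < N.+1)%N by rewrite ltnS PN.
  by apply: (bigmax_sup (Ordinal lt_n0)) => //=; rewrite kP// tn0.
move=> w; split.
  move=> /big_riesz_join_le[_ xw] n Pn.
  have lt_n : (n < N.+1)%N by rewrite ltnS PN.
  by have := xw (Ordinal lt_n) (mem_index_enum _); rewrite /= kP.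
by move=> xw; apply/big_riesz_join_le; split=> [|i _]; exact/xw/Pk.
Qed.

Lemma riesz_le_shift x y s t e :
  x <= y + s *: u -> s + t <= e -> x + t *: u <= y + e *: u.
Proof.
move=> xy ste; apply: le_trans (riesz_leD2r (t *: u) _ _ xy) _.
rewrite -addrA -scalerDl; apply: riesz_leD => //; exact: riesz_leZ.
Qed.

(** The nonpositive weights bound z from above, and the term of weight 0 bounds
it from below. *)
Lemma is_join_within_unit P (c : nat -> E) (t : nat -> R) n0 e x z :
  is_join P (fun n => c n + t n *: u) z ->
  (forall n, P n -> t n <= 0) -> P n0 -> t n0 = 0 ->
  (forall n, P n -> within_unit u e (c n) x) ->
  within_unit u e z x.
Proof.
move=> zJ t0 Pn0 tn0 cx; split.
  apply/(zJ _).2 => n Pn; apply: riesz_le_shift (cx n Pn).1 _.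
  by rewrite gerDl t0.
have /(_ n0 Pn0) := (zJ z).1 (lexx _).
rewrite tn0 scale0r addr0 => /(riesz_leD2r (e *: u)).
exact/le_trans/(cx n0 Pn0).2.
Qed.

(** For M > 0, the value at r of an increasing function from (M / 2, M] to
(-oo, 0] that tends to -oo at M / 2 and vanishes at M. *)
Definition weight (M r : R) := 1 - M / (2 * r - M).

Lemma weight_le0 M r : M < 2 * r -> r <= M -> weight M r <= 0.
Proof. by move=> Mr rM; rewrite subr_le0 ler_pdivlMr; lra. Qed.

Lemma weight_max M : 0 < M -> weight M M = 0.
Proof.
by move=> M0; rewrite /weight (_ : 2 * M - M = M) ?divff ?subrr ?gt_eqF//; lra.
Qed.

(** As N bounds the indices in use near y0, it suffices to treat one n. If n is
used at y0, then it is used nearby and its term varies continuously. If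
g n y0 <= 0, then n is not used nearby. The remaining case is
0 < 2 g n y0 <= M y0: there n may be used arbitrarily close to y0, but with a
weight so low that the term stays below F y0. *)
Lemma maxplus_join_near (Y : topologicalType) (y0 : Y) (g : nat -> Y -> R)
    (M : Y -> R) (c : nat -> Y -> E) (F : Y -> E) N :
  {for y0, continuous M} -> (forall n, {for y0, continuous (g n)}) ->
  0 < M y0 ->
  (\forall y \near y0, forall n, M y < 2 * g n y -> (n < N)%N) ->
  (forall n, 0 < g n y0 -> \forall y \near y0, c n y = c n y0) ->
  (\forall y \near y0, is_join [set n | M y < 2 * g n y]
     (fun n => c n y + weight (M y) (g n y) *: u) (F y)) ->
  forall e, 0 < e -> \forall y \near y0, within_unit u e (F y) (F y0).
Proof.
move=> Mc gc M0 gN cc FJ e e0.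
have FJ0 := nbhs_singleton FJ; have gN0 := nbhs_singleton gN.
have weight_cvg n : M y0 < 2 * g n y0 ->
    weight (M y) (g n y) @[y --> y0] --> weight (M y0) (g n y0).
  move=> Mg; apply: cvgB; first exact: cvg_cst.
  apply: cvgM; first exact: Mc.
  apply: cvgV; first by rewrite gt_eqF// subr_gt0.
  apply: cvgB; last exact: Mc.
  by apply: cvgM; [exact: cvg_cst | exact: gc].
have weight_near n : M y0 < 2 * g n y0 -> \forall y \near y0,
    `|weight (M y0) (g n y0) - weight (M y) (g n y)| < e.
  by move=> /weight_cvg/cvgrPdist_lt; apply.
have active_gt0 n (y : Y) : 0 < M y -> M y < 2 * g n y -> 0 < g n y by lra.
have upper n : \forall y \near y0, M y < 2 * g n y ->
    c n y + weight (M y) (g n y) *: u <= F y0 + e *: u.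
  have [g0|g0] := ltP 0 (g n y0); last first.
    have gM0 : 2 * g n y0 - M y0 < 0 by lra.
    have gM_near : \forall y \near y0, 2 * g n y - M y < 0.
      apply: cvgr_lt gM0; apply: cvgB; last exact: Mc.
      by apply: cvgM; [exact: cvg_cst | exact: gc].
    near=> y => Mg; have : 2 * g n y - M y < 0 by near: y.
    by rewrite subr_lt0 => /(lt_trans Mg); rewrite ltxx.
  have [Mg|gM] := ltP (M y0) (2 * g n y0).
    near=> y => _; rewrite (near (cc n g0) y)//.
    apply: le_trans (riesz_leD2r _ _ _ ((FJ0 (F y0)).1 (lexx _) n Mg)).
    rewrite -[leRHS]addrA -scalerDl; apply: riesz_leD => //; apply: riesz_leZ => //.
    have : `|weight (M y0) (g n y0) - weight (M y) (g n y)| < e.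
      by near: y; exact: weight_near.
    by rewrite ltr_norml; lra.
  (* A weight below - K suffices; as long as M < 2 g, this amounts to
     (1 + K) (2 g - M) <= M. *)
  have [K K0 cK] := pu_ubound u_unit (c n y0 - F y0).
  have gM0 : (1 + K) * (2 * g n y0 - M y0) - M y0 < 0.
    by have := mulr_ge0 K0 (_ : 0 <= M y0 - 2 * g n y0); rewrite subr_ge0; nra.
  have gM_near : \forall y \near y0, (1 + K) * (2 * g n y - M y) - M y < 0.
    apply: cvgr_lt gM0; apply: cvgB; last exact: Mc.
    apply: cvgM; first exact: cvg_cst.
    apply: cvgB; last exact: Mc.
    by apply: cvgM; [exact: cvg_cst | exact: gc].
  near=> y => Mg; rewrite (near (cc n g0) y)//.
  have {}cK : c n y0 <= F y0 + K *: u.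
    by move: cK => /(riesz_leD2r (F y0)); rewrite subrK addrC.
  apply: riesz_le_shift cK _.
  have : weight (M y) (g n y) <= - K; last by lra.
  rewrite /weight lerBlDr -lerBlDl ler_pdivlMr ?subr_gt0//.
  have : (1 + K) * (2 * g n y - M y) - M y < 0 by near: y.
  lra.
have lower n : \forall y \near y0, M y0 < 2 * g n y0 ->
    c n y0 + weight (M y0) (g n y0) *: u <=
    c n y + weight (M y) (g n y) *: u + e *: u /\ M y < 2 * g n y.
  have [Mg|_] := ltP (M y0) (2 * g n y0); last by apply: nearW.
  have gM0 : 0 < 2 * g n y0 - M y0 by rewrite subr_gt0.
  have gM_near : \forall y \near y0, 0 < 2 * g n y - M y.
    apply: cvgr_gt gM0; apply: cvgB; last exact: Mc.
    by apply: cvgM; [exact: cvg_cst | exact: gc].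
  near=> y => _; split; last by rewrite -subr_gt0; near: y.
  rewrite (near (cc n (active_gt0 _ _ M0 Mg)) y)// -[leRHS]addrA -scalerDl.
  apply: riesz_leD => //; apply: riesz_leZ => //.
  have : `|weight (M y0) (g n y0) - weight (M y) (g n y)| < e.
    by near: y; exact: weight_near.
  by rewrite ltr_norml; lra.
have upperN : \forall y \near y0, forall n : 'I_N, M y < 2 * g n y ->
    c n y + weight (M y) (g n y) *: u <= F y0 + e *: u.
  by apply: filter_forall => i; exact: upper.
have lowerN : \forall y \near y0, forall n : 'I_N, M y0 < 2 * g n y0 ->
    c n y0 + weight (M y0) (g n y0) *: u <=
    c n y + weight (M y) (g n y) *: u + e *: u /\ M y < 2 * g n y.
  by apply: filter_forall => i; exact: lower.
near=> y; have FJy : is_join [set n | M y < 2 * g n y]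
    (fun n => c n y + weight (M y) (g n y) *: u) (F y) by near: y.
split.
  have gNy : forall n, M y < 2 * g n y -> (n < N)%N by near: y.
  have Fy : forall n : 'I_N, M y < 2 * g n y ->
    c n y + weight (M y) (g n y) *: u <= F y0 + e *: u by near: y.
  by apply/(FJy _).2 => n Mgn; exact: (Fy (Ordinal (gNy n Mgn))).
apply/(FJ0 _).2 => n Mgn.
have /(_ (Ordinal (gN0 n Mgn)) Mgn) [+ Mgny] : forall n : 'I_N, M y0 < 2 * g n y0 ->
    c n y0 + weight (M y0) (g n y0) *: u <=
    c n y + weight (M y) (g n y) *: u + e *: u /\ M y < 2 * g n y by near: y.
move=> /le_trans; apply; apply: riesz_leD2r.
exact: (FJy (F y)).1 (lexx _) n Mgny.
Unshelve. all: by end_near. Qed.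

End MaxPlus.

(** * Extension of maps into a max-plus convex set *)

Section Extension.
Context {R : realType} {Y : topologicalType} {d : Y -> Y -> R} {A : set Y}.
Hypothesis d_metric : is_metric d.
Hypothesis nbhs_d : forall x, nbhs x =
  filter_from [set e : R | 0 < e] (fun e => [set y | d x y < e]).
Hypothesis A_closed : closed A.

(** The factor 2 leaves room for the sets to be neighbourhoods of the points off
A, where a nearest point of A need not exist. *)
Definition almost_nearest (a : A) : set Y :=
  [set y | forall b : A, d y (set_val a) <= 2 * d y (set_val b)].

Lemma almost_nearest_cover (a0 : A) y : ~ A y ->
  exists a, (almost_nearest a)° y.
Proof.
case: d_metric => _ dC d_triangle nAy.
pose S := range (fun b : A => d y (set_val b)).
have [r r0 rS] : exists2 r, 0 < r & forall b : A, r <= d y (set_val b).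
  have : nbhs y (~` A) by apply: open_nbhs_nbhs; split=> //; exact: closed_openC.
  rewrite nbhs_d => -[r r0 rA]; exists r => // b; rewrite leNgt; apply/negP.
  by move=> /rA; apply; exact: set_valP.
have Sinf : has_inf S.
  by split; [exists (d y (set_val a0)), a0|exists r => _ [b _ <-]].
have rinf : r <= inf S by apply: lb_le_inf Sinf.1 _ => _ [b _ <-].
have infS (b : A) : inf S <= d y (set_val b) by apply: ge_inf Sinf.2 _ _; exists b.
have infS0 : 0 < inf S by exact: lt_le_trans rinf.
have [|_ [a _ <-] ya] := @inf_adherent _ S (inf S / 2) _ Sinf.
  by rewrite divr_gt0.
(* With I the infimum, d y a < 3 I / 2, and in the ball of radius I / 6 about y
   both sides of the required inequality stay on their side of 5 I / 3. *)
exists a; rewrite /interior /= nbhs_d; exists (inf S / 6) => /=; first by lra.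
move=> z /= yz b; have := infS b; have := d_triangle z y (set_val a).
by have := d_triangle y z (set_val b); have := dC y z; lra.
Qed.

(** Off A, F is the supremum of f (k n) + t n u over the n with M < 2 g n, as
explained at the top. At a point y of A, a nearby z off A satisfies
d y (k n z) <= d y z + d z (k n z) <= 3 d y z, since k n z is almost nearest
to z and y competes with it. *)
Lemma maxplus_extension (E : rieszType R) (u : E) (u_unit : riesz_unit u)
    (C : set E) (f : A -> E) (a0 : A) :
  maxplus_convex u C -> (forall a, C (f a)) ->
  (forall a e, 0 < e -> exists2 r, 0 < r & forall b : A,
     d (set_val a) (set_val b) < r -> within_unit u e (f b) (f a)) ->
  exists F : Y -> E, [/\ forall y, C (F y), forall a, F (set_val a) = f a &
    forall y e, 0 < e -> \forall z \near y, within_unit u e (F z) (F y)].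
Proof.
move=> CE Cf f_cont; have [_ dC d_triangle] := d_metric.
have [g [k [g_bound g_lip g_gt0 gO k_const]]] := sigma_discrete_bumps
  d_metric nbhs_d a0 (fun a => open_interior (almost_nearest a)).
pose M y := sup (range (g ^~ y)).
have gM n y : g n y <= M y.
  apply: ub_le_sup; last by exists n.
  exact: null_sequence_ubound (g_bound ^~ y).
have M_lip : nonexpansive d M.
  have -> : M = (fun y => sup [set h y | h in range g]).
    by apply/funext => y; rewrite image_comp.
  apply: nonexpansive_sup => [|y|_ [n _ <-]//]; first by exists (g 0%N), 0%N.
  by rewrite image_comp; exact: null_sequence_ubound (g_bound ^~ y).
have M_gt0 y : ~ A y -> exists n, g n y = M y /\ 0 < g n y.
  move=> /(almost_nearest_cover a0)[a /g_gt0[n gn]].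
  have [m gm] := null_sequence_max (g_bound ^~ y) gn; exists m; split => //.
  by rewrite gm; apply: lt_le_trans gn _; exact: gM.
have few m : 0 < m -> exists N, forall n y, m < g n y -> (n < N)%N.
  move=> m0; have [N _ NP] := near_infty_natSinv_lt (PosNum m0).
  exists N => n y mg; rewrite ltnNge; apply/negP => /NP/= nm.
  have /andP[_ /le_lt_trans/(_ nm)/(lt_trans mg)] := g_bound n y.
  by rewrite ltxx.
pose active y := [set n | M y < 2 * g n y].
pose term y n := f (k n y) + weight (M y) (g n y) *: u.
have weight0 y n : active y n -> weight (M y) (g n y) <= 0.
  by move=> yn; exact: weight_le0.
have /choice[F FP] y : exists z, C z /\ (forall a, set_val a = y -> z = f a) /\
    (~ A y -> is_join (active y) (term y) z).
  have [Ay|nAy] := pselect (A y).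
    exists (f (SigSub (mem_set Ay))); split => //; split => // a ay.
    by congr f; apply: val_inj.
  have [n [gn gn0]] := M_gt0 y nAy.
  have [|N NP] := few (M y / 2); first by rewrite -gn; lra.
  have [|||||z Cz zJ] := @maxplus_join_mem _ _ _ C N (active y)
    (fun n => f (k n y)) (fun n => weight (M y) (g n y)) n CE.
  - by move=> m; rewrite /active /= => my; apply/ltnW/(NP m y); lra.
  - by [].
  - exact: weight0.
  - by rewrite /active /= -gn; lra.
  - by rewrite gn weight_max// -gn.
  exists z; split => //; split => // a ay.
  by exfalso; apply: nAy; rewrite -ay; exact: set_valP.
exists F; split=> [y|a|y e e0]; first by case: (FP y).
  by case: (FP (set_val a)) => _ [/(_ a)->].
have FJ z : ~ A z -> is_join (active z) (term z) (F z) by case: (FP z) => _ [].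
have [Ay|nAy] := pselect (A y).
  have [r r0 fr] := f_cont (SigSub (mem_set Ay)) e e0.
  have -> : F y = f (SigSub (mem_set Ay)) by case: (FP y) => _ [+ _]; apply.
  near=> z; have yz : d y z < r / 3.
    by near: z; apply: near_dist => //; rewrite divr_gt0.
  have [Az|nAz] := pselect (A z).
    have -> : F z = f (SigSub (mem_set Az)) by case: (FP z) => _ [+ _]; apply.
    by apply: fr => /=; lra.
  have [n [gn gn0]] := M_gt0 z nAz.
  apply: (is_join_within_unit (n0 := n) u_unit (FJ z nAz)).
  - exact: weight0.
  - by rewrite /active /= -gn; lra.
  - by rewrite gn weight_max// -gn.
  move=> m; rewrite /active/= => mz; apply: fr => /=.
  have gm0 : 0 < g m z by move: gn0; rewrite gn; lra.
  have /(_ (SigSub (mem_set Ay))) := interior_subset (gO m z gm0).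
  have := d_triangle y z (set_val (k m z)).
  by rewrite [set_val (SigSub _)]/= (dC z y); lra.
have [n [gn gn0]] := M_gt0 y nAy.
have [|N NP] := few (M y / 4); first by rewrite -gn; lra.
have M0 : 0 < M y by rewrite -gn.
have M_cont := nonexpansive_continuous d_metric nbhs_d M_lip (x := y).
apply: (maxplus_join_near u_unit (g := g) (M := M) (N := N)
  (c := fun n y => f (k n y))) => //.
- by move=> m; exact: (nonexpansive_continuous d_metric nbhs_d (g_lip m) (x := y)).
- near=> z => m mz; apply: (NP m z).
  suff : M y / 2 < M z by lra.
  by near: z; apply: (cvgr_gt _ M_cont); lra.
- by move=> m /k_const; apply: filterS => z ->.
- near=> z; apply: FJ; near: z.
  by apply: open_nbhs_nbhs; split=> //; exact: closed_openC.
Unshelve. all: by end_near. Qed.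

End Extension.

(** * Metrizability and retractions *)

Lemma metrizable_metricType (R : realType) (X : metricType R) : metrizable R X.
Proof.
exists (@mdist R X).
  split; [move=> x y; split=> [/mdist_positivity//|->] | |].
  - exact: mdistxx.
  - exact: metric_sym.
  - by move=> x y z; exact: metric_triangle.
move=> x; rewrite -filter_from_ballE; congr filter_from.
by apply/funext => e; rewrite ballEmdist.
Qed.

Lemma metrizable_set_type (R : realType) (X : topologicalType) (A : set X) :
  metrizable R X -> metrizable R (set_type A).
Proof.
move=> [d [d0 dC d_triangle] nbhs_d].
exists (fun x y => d (set_val x) (set_val y)).
  split=> [x y|x y|x y z] //; split=> [/d0/val_inj//|->]; exact/d0.
move=> x; apply/seteqP; split=> [P [_ [[U Uo <-] Ux UP]]|P [e /= e0 eP]].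
  have : nbhs (set_val x) U by apply: open_nbhs_nbhs; split.
  by rewrite nbhs_d => -[e e0 eU]; exists e => // y /eU/UP.
have xe : nbhs (set_val x) [set y | d (set_val x) y < e].
  by rewrite nbhs_d; exists e.
exact: filterS eP (@initial_continuous _ _ set_val x _ xe).
Qed.

Theorem theorem6 (R : realType) (E : rieszType R) (u : E)
  (E_neq0 : riesz_nontrivial E) (E_archi : riesz_archimedean E)
  (u_unit : riesz_unit u) (C : set E)
  (C_neq0 : C !=set0) (C_convex : maxplus_convex u C) :
  absolute_retract R
    (set_type (C : set (hu_space E_neq0 E_archi u_unit))).
Proof.
set H := hu_space E_neq0 E_archi u_unit.
split; first exact/metrizable_set_type/metrizable_metricType.
move=> Y A [d d_metric nbhs_d] A_closed [h [f [h_cont f_cont hK fK]]].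
have [c0 Cc0] := C_neq0.
have C_mem (c : set_type (C : set H)) : C (set_val c) by exact: set_valP.
have [|F [CF F_ext F_cont]] := maxplus_extension d_metric nbhs_d A_closed
    u_unit (f := fun a => set_val (f a) : E) (h (SigSub (mem_set Cc0)))
    C_convex (fun a => C_mem (f a)).
  move=> a e e0.
  have : \forall b \near a, Dhu u (set_val (f a)) (set_val (f b)) < e.
    have fae : nbhs (set_val (f a) : H)
        [set y : H | Dhu u (set_val (f a)) y < e].
      by apply/nbhs_ballP; exists e.
    exact: (f_cont a _ (@initial_continuous _ _ set_val (f a) _ fae)).
  move=> [_ [[U Uo <-] Ua Ue]].
  have : nbhs (set_val a) U by apply: open_nbhs_nbhs; split.
  rewrite nbhs_d => -[r /= r0 rU]; exists r => // b /rU/Ue/ltW.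
  by move=> /(Dhu_within_unit u_unit E_neq0 E_archi)/within_unit_sym.
pose G y : set_type (C : set H) := SigSub (mem_set (CF y)).
have G_cont : continuous G.
  apply: continuous_comp_initial => y.
  apply/cvg_ballP => e e0.
  have e30 : 0 < e / 3 by rewrite divr_gt0.
  apply: filterS (F_cont y _ e30) => z /within_unit_sym Fzy.
  rewrite ballEmdist /=.
  apply: le_lt_trans (within_unit_Dhu u_unit E_neq0 (ltW e30) Fzy) _.
  lra.
exists (h \o G).
  by move=> y; apply: continuous_comp; [exact: G_cont | exact: h_cont].
move=> a /=; rewrite -[RHS]fK; congr h; apply: val_inj.
exact: F_ext.
Qed.
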